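(* Let $(S, \ast, \varepsilon, \alpha_S)$ be a Hom-left-symmetric color algebra and $(A, \cdot, \varepsilon, \alpha_A)$ a commutative Hom-associative color algebra (graded by the same abelian group $G$ and with the same bicharacter $\varepsilon$). Then $(S\otimes A, \circ, \varepsilon, \alpha_{S\otimes A})$ is a Hom-left-symmetric color algebra, where $$\alpha_{S\otimes A}=\alpha_S\otimes\alpha_A,\qquad (x\otimes a)\circ(y\otimes b)=\varepsilon(a, y)\,(x\ast y)\otimes(a\cdot b)$$ for all $x, y\in \mathcal{H}(S)$ and $a, b\in \mathcal{H}(A)$.
   Context: All vector spaces are over a field $\mathbb{K}$ of characteristic different from $2$, $G$ is an abelian group, and a linear map or bilinear map between $G$-graded spaces is called even if it preserves degree. $\mathcal{H}(A)$ denotes the set of homogeneous elements of a $G$-graded space $A$. A tensor product of graded spaces carries the total grading. A bicharacter on $G$ is a map $\varepsilon:G\times G\to\mathbb{K}^*$ with $\varepsilon(a,b)\varepsilon(b,a)=1$, $\varepsilon(a,b+c)=\varepsilon(a,b)\varepsilon(a,c)$, $\varepsilon(a+b,c)=\varepsilon(a,c)\varepsilon(b,c)$ for all $a,b,c\in G$. For homogeneous $x,y$ of degrees $a,b$ one writes $\varepsilon(x,y):=\varepsilon(a,b)$. A Hom-associative color algebra $(A,\mu,\varepsilon,\alpha)$ is a $G$-graded linear space $A$ with an even bilinear map $\mu$, a bicharacter $\varepsilon$ and an even linear map $\alpha:A\to A$ such that $\mu(\alpha(x),\mu(y,z))=\mu(\mu(x,y),\alpha(z))$ for all $x,y,z\in\mathcal{H}(A)$.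 It is commutative if moreover $\mu(x,y)=\varepsilon(x,y)\mu(y,x)$ for all $x,y\in\mathcal{H}(A)$. A Hom-left-symmetric color algebra $(S,\cdot,\varepsilon,\alpha)$ is a $G$-graded linear space $S$ with an even bilinear multiplication $\cdot$, a bicharacter $\varepsilon$ and an even linear map $\alpha:S\to S$ such that for all $x,y,z\in\mathcal{H}(S)$ $$(x\cdot y)\cdot\alpha(z)-\alpha(x)\cdot(y\cdot z)=\varepsilon(x, y)\big((y\cdot x)\cdot\alpha(z)-\alpha(y)\cdot(x\cdot z)\big).$$ *)

(* Defs.v *)
From HB Require Import structures.
From mathcomp Require Import all_boot all_algebra.
From mathcomp Require Import boolp.
From mathcomp Require Import freeg.

Set Implicit Arguments.
Unset Strict Implicit.
Unset Printing Implicit Defensive.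

Import GRing.Theory.
Local Open Scope ring_scope.
Local Open Scope quotient_scope.

Section TensorProduct.
Variables (K : fieldType) (U V : lmodType K).

Local Notation free := {freeg (U * V)%type / K}.

(* The tensor product is the quotient of the free vector space on U * V by the
   subspace spanned by the bilinearity relations. *)
Inductive bilin_rel : free -> Prop :=
| bilin_rel0 : bilin_rel 0
| bilin_relP c s t : bilin_rel s -> bilin_rel t -> bilin_rel (c *: s + t)
| bilin_relDl x y a :
    bilin_rel (<< (x + y, a) >> - << (x, a) >> - << (y, a) >>)
| bilin_relDr x a b :
    bilin_rel (<< (x, a + b) >> - << (x, a) >> - << (x, b) >>)
| bilin_relZl c x a : bilin_rel (<< (c *: x, a) >> - c *: << (x, a) >>)
| bilin_relZr c x a : bilin_rel (<< (x, c *: a) >> - c *: << (x, a) >>).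

Definition bilin_relb : {pred free} := fun s => `[< bilin_rel s >].

Lemma bilin_rel_submod : submod_closed bilin_relb.
Proof.
split; first by apply/asboolP; exact: bilin_rel0.
by move=> c s t /asboolP rs /asboolP rt; apply/asboolP; apply: bilin_relP.
Qed.

HB.instance Definition _ :=
  GRing.isSubmodClosed.Build K free bilin_relb bilin_rel_submod.

Definition tensor : Type := Quotient.quot bilin_relb.

HB.instance Definition _ := GRing.Zmodule.on tensor.

Let pi (s : free) : tensor := \pi_(Quotient.quot bilin_relb) s.

Let piE (s t : free) : (pi s = pi t) <-> bilin_rel (s - t).
Proof.
split=> [/eqP|] h.
  by apply/asboolP; rewrite -[`[< _ >]]/(s - t \in bilin_relb)
     Quotient.idealrBE.
by apply/eqP; rewrite -Quotient.idealrBE; apply/asboolP.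
Qed.

Let piD s t : pi (s + t) = pi s + pi t.
Proof. exact: Quotient.pi_add. Qed.

Definition tensor_scale (c : K) (t : tensor) : tensor :=
  \pi_(Quotient.quot bilin_relb) (c *: (repr t : free)).

Let pi_repr (t : tensor) : pi (repr t) = t.
Proof. exact: reprK. Qed.

Let piZ c s : tensor_scale c (pi s) = pi (c *: s).
Proof.
apply/piE; rewrite -scalerBr -[_ *: _]addr0; apply: bilin_relP bilin_rel0.
by apply/piE; rewrite pi_repr.
Qed.

Lemma tensor_scaleA c d t :
  tensor_scale c (tensor_scale d t) = tensor_scale (c * d) t.
Proof. by rewrite -[t]pi_repr !piZ scalerA. Qed.

Lemma tensor_scale1 : left_id 1 tensor_scale.
Proof. by move=> t; rewrite -[t]pi_repr piZ scale1r. Qed.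

Lemma tensor_scaleDr : right_distributive tensor_scale +%R.
Proof.
by move=> c s t; rewrite -[s]pi_repr -[t]pi_repr -piD !piZ -piD scalerDr.
Qed.

Lemma tensor_scaleDl t : {morph tensor_scale^~ t : c d / c + d}.
Proof. by move=> c d; rewrite -[t]pi_repr !piZ -piD scalerDl. Qed.

HB.instance Definition _ := GRing.Zmodule_isLmodule.Build K tensor
  tensor_scaleA tensor_scale1 tensor_scaleDr tensor_scaleDl.

Definition tens (x : U) (a : V) : tensor :=
  \pi_(Quotient.quot bilin_relb) (<< (x, a) >> : free).

Let piP c s t : pi (c *: s + t) = c *: pi s + pi t.
Proof. by rewrite piD -piZ. Qed.

Let piB s t : pi (s - t) = pi s - pi t.
Proof. by rewrite -scaleN1r addrC piP scaleN1r addrC. Qed.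

Let pi0 s : bilin_rel s -> pi s = 0.
Proof. by move=> rs; rewrite -[RHS](subrr (pi 0)) -piB; apply/piE;
  rewrite !subr0. Qed.

Let tensDl x y a : tens (x + y) a = tens x a + tens y a.
Proof.
have /pi0 := bilin_relDl x y a; rewrite !piB -addrA -opprD => /eqP.
by rewrite subr_eq0 => /eqP.
Qed.

Let tensDr x a b : tens x (a + b) = tens x a + tens x b.
Proof.
have /pi0 := bilin_relDr x a b; rewrite !piB -addrA -opprD => /eqP.
by rewrite subr_eq0 => /eqP.
Qed.

Let tensZl c x a : tens (c *: x) a = c *: tens x a.
Proof.
have /pi0 := bilin_relZl c x a; rewrite piB -piZ => /eqP.
by rewrite subr_eq0 => /eqP.
Qed.

Let tensZr c x a : tens x (c *: a) = c *: tens x a.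
Proof.
have /pi0 := bilin_relZr c x a; rewrite piB -piZ => /eqP.
by rewrite subr_eq0 => /eqP.
Qed.

Lemma tens_bilinear : bilinear_for *:%R *:%R tens.
Proof.
by split=> [a c x y|x c a b]; rewrite /= (tensDl, tensDr) (tensZl, tensZr).
Qed.

HB.instance Definition _ :=
  bilinear_isBilinear.Build K U V tensor *:%R *:%R tens tens_bilinear.

Lemma tensor_span (t : tensor) :
  exists s : seq (U * V), t = \sum_(p <- s) tens p.1 p.2.
Proof.
rewrite -[t]pi_repr; set s := repr t.
exists [seq (coeff z s *: z.1, z.2) | z <- dom s].
rewrite big_map -{1}[s]freeg_sumE.
elim: (dom s) => [|z r IH]; first by rewrite !big_nil; apply: pi0; exact: bilin_rel0.
rewrite !big_cons -IH tensZl /=.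
have -> : << coeff z s *g z >> = coeff z s *: << (z.1, z.2) >> :> free.
  by apply/eqP/freeg_eqP => y; rewrite coeffZ !coeffU mul1r; case: z.
exact: piP.
Qed.

Section Lift.
Variables (W : lmodType K) (f : {bilinear U -> V -> W}).

(* The universal property of the tensor product, see [tensor_liftE]. *)
Definition tensor_lift (t : tensor) : W :=
  fglift (fun p : U * V => f p.1 p.2) (repr t : free).

Let F (s : free) : W := fglift (fun p : U * V => f p.1 p.2) s.

Let FB s t : F (s - t) = F s - F t.
Proof. exact: lift_is_additive. Qed.

Let F1 x a : F << (x, a) >> = f x a.
Proof. by rewrite /F liftU scale1r. Qed.

Let F0 : F 0 = 0. Proof. by rewrite -(subrr 0) FB subrr. Qed.
Let FN s : F (- s) = - F s. Proof. by rewrite -sub0r FB F0 sub0r. Qed.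
Let FD s t : F (s + t) = F s + F t.
Proof. by rewrite -{1}[t]opprK FB FN opprK. Qed.

Let FZ c s : F (c *: s) = c *: F s.
Proof.
rewrite -[s]freeg_sumE scaler_sumr.
elim: (dom s) => [|z r IH]; first by rewrite !big_nil F0 scaler0.
rewrite !big_cons !FD IH scalerDr; congr (_ + _).
have -> : c *: << coeff z s *g z >> = << c * coeff z s *g z >> :> free.
  by apply/eqP/freeg_eqP => y; rewrite coeffZ !coeffU mulrA.
by rewrite /F !liftU scalerA.
Qed.

Let F_rel s : bilin_rel s -> F s = 0.
Proof.
elim=> {s} [|c s t _ Fs _ Ft|x y a|x a b|c x a|c x a].
- exact: F0.
- by rewrite FD FZ Fs Ft scaler0 addr0.
- by rewrite !FB !F1 linearDl addrAC addrK subrr.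
- by rewrite !FB !F1 linearDr addrAC addrK subrr.
- by rewrite FB FZ !F1 linearZl_LR subrr.
- by rewrite FB FZ !F1 linearZr_LR subrr.
Qed.

Let lift_pi s : tensor_lift (pi s) = F s.
Proof.
by apply/eqP; rewrite -subr_eq0 -[_ - _]FB F_rel //; apply/piE; rewrite pi_repr.
Qed.

Lemma tensor_lift_linear : linear tensor_lift.
Proof.
by move=> c s t; rewrite -[s]pi_repr -[t]pi_repr -piP !lift_pi FD FZ.
Qed.

HB.instance Definition _ :=
  GRing.isLinear.Build K tensor W *:%R tensor_lift tensor_lift_linear.

Lemma tensor_liftE x a : tensor_lift (tens x a) = f x a.
Proof. by rewrite lift_pi F1. Qed.

End Lift.
End TensorProduct.

Notation "x \ot a" := (tens x a) (at level 40, left associativity) : ring_scope.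

Section TensorMap.
Variables (K : fieldType) (U V U' V' : lmodType K).
Variables (f : {linear U -> U'}) (g : {linear V -> V'}).

Definition tens_map (x : U) (a : V) : tensor U' V' := f x \ot g a.

Lemma tens_map_bilinear : bilinear_for *:%R *:%R tens_map.
Proof.
split=> [a c x y|x c a b]; rewrite /tens_map linearP.
  by rewrite linearPl.
by rewrite linearPr.
Qed.

HB.instance Definition _ :=
  bilinear_isBilinear.Build K U V (tensor U' V') *:%R *:%R tens_map
    tens_map_bilinear.

Definition tensor_map : tensor U V -> tensor U' V' := tensor_lift tens_map.

HB.instance Definition _ := GRing.Linear.on tensor_map.

Lemma tensor_mapE x a : tensor_map (x \ot a) = f x \ot g a.
Proof. exact: tensor_liftE. Qed.

End TensorMap.

Section Graded.
Variables (K : fieldType) (G : zmodType).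

(* [gr g] is the subspace of elements of degree g (0 has every degree), and
   the space is the internal direct sum of these subspaces. *)
Record is_grading (V : lmodType K) (gr : G -> V -> Prop) : Prop := IsGrading {
  grading0 : forall g, gr g 0;
  gradingP : forall g (c : K) u v, gr g u -> gr g v -> gr g (c *: u + v);
  grading_span : forall v, exists (s : seq G) (f : G -> V),
    (forall g, gr g (f g)) /\ v = \sum_(g <- s) f g;
  grading_direct : forall (s : seq G) (f : G -> V), uniq s ->
    (forall g, gr g (f g)) -> \sum_(g <- s) f g = 0 ->
    forall g, g \in s -> f g = 0 }.

Definition even_linear (V : lmodType K) (gr : G -> V -> Prop) (f : V -> V) :=
  forall g x, gr g x -> gr g (f x).

Definition even_bilinear (V : lmodType K) (gr : G -> V -> Prop)
    (mu : V -> V -> V) :=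
  forall g h x y, gr g x -> gr h y -> gr (g + h) (mu x y).

Record bicharacter (eps : G -> G -> K) : Prop := Bicharacter {
  bichar_neq0 : forall a b, eps a b != 0;
  bichar_skew : forall a b, eps a b * eps b a = 1;
  bicharDr : forall a b c, eps a (b + c) = eps a b * eps a c;
  bicharDl : forall a b c, eps (a + b) c = eps a c * eps b c }.

Record hom_associative_color (V : lmodType K) (gr : G -> V -> Prop)
    (mu : {bilinear V -> V -> V}) (eps : G -> G -> K)
    (alpha : {linear V -> V}) : Prop := HomAssociativeColor {
  hac_grading : is_grading gr;
  hac_mul_even : even_bilinear gr mu;
  hac_bichar : bicharacter eps;
  hac_alpha_even : even_linear gr alpha;
  hac_assoc : forall a b c x y z, gr a x -> gr b y -> gr c z ->
    mu (alpha x) (mu y z) = mu (mu x y) (alpha z) }.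

Definition color_commutative (V : lmodType K) (gr : G -> V -> Prop)
    (mu : V -> V -> V) (eps : G -> G -> K) :=
  forall a b x y, gr a x -> gr b y -> mu x y = eps a b *: mu y x.

Record hom_left_symmetric_color (V : lmodType K) (gr : G -> V -> Prop)
    (mu : {bilinear V -> V -> V}) (eps : G -> G -> K)
    (alpha : {linear V -> V}) : Prop := HomLeftSymmetricColor {
  hlsc_grading : is_grading gr;
  hlsc_mul_even : even_bilinear gr mu;
  hlsc_bichar : bicharacter eps;
  hlsc_alpha_even : even_linear gr alpha;
  hlsc_left_sym : forall a b c x y z, gr a x -> gr b y -> gr c z ->
    mu (mu x y) (alpha z) - mu (alpha x) (mu y z) =
    eps a b *: (mu (mu y x) (alpha z) - mu (alpha y) (mu x z)) }.

(* The degree g part is the sum of the subspaces U_h (x) V_k with h + k = g. *)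
Definition tensor_grading (U V : lmodType K) (grU : G -> U -> Prop)
    (grV : G -> V -> Prop) (g : G) (t : tensor U V) : Prop :=
  exists s : seq (U * V),
    t = \sum_(p <- s) p.1 \ot p.2 /\
    forall p, p \in s ->
      exists h k, [/\ grU h p.1, grV k p.2 & h + k = g].

Definition is_color_tensor_mul (U V : lmodType K) (grU : G -> U -> Prop)
    (grV : G -> V -> Prop) (muU : U -> U -> U) (muV : V -> V -> V)
    (eps : G -> G -> K) (mu : tensor U V -> tensor U V -> tensor U V) :=
  forall dx da dy db x a y b,
    grU dx x -> grV da a -> grU dy y -> grV db b ->
    mu (x \ot a) (y \ot b) = eps da dy *: (muU x y \ot muV a b).

End Graded.

(* Main.v *)
(** A homogeneous decomposition of every vector is chosen; the sum of
    [phi g v_g] over the components [v_g] of [v] does not depend on the choice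
    because the grading is direct, so it is linear in [v].  This yields the
    bilinear twist [(a, y) |-> sum eps g h *: f a_g y_h], hence the product on
    the tensor product, and also the projections of the tensor product onto its
    degrees.  On homogeneous pure tensors the Hom-associator of [x (x) a],
    [y (x) b], [z (x) c] is [eps a y * eps a z * eps b z] times
    [as(x, y, z) (x) (ab)alpha(c)], by Hom-associativity of [A]; exchanging
    [x (x) a] and [y (x) b] then only uses left symmetry of [S] and
    [ab = eps a b *: ba]. *)

Require Import Defs.
From HB Require Import structures.
From mathcomp Require Import all_boot all_algebra.
From mathcomp Require Import boolp ring.

Set Implicit Arguments.
Unset Strict Implicit.
Unset Printing Implicit Defensive.

Import GRing.Theory.
Local Open Scope ring_scope.

(** * Regrouping of finite sums, and linearity of bare functions *)

Lemma sum_regroup (I J : eqType) (V : zmodType) (r : seq I) (d : I -> J)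
    (F : I -> V) :
  \sum_(i <- r) F i =
  \sum_(j <- undup (map d r)) \sum_(i <- r | d i == j) F i.
Proof.
under [RHS]eq_bigr => j _ do rewrite big_mkcond.
rewrite exchange_big [LHS]big_seq [RHS]big_seq; apply: eq_bigr => i ri.
(* After the exchange, the index [i] contributes only to its own class [j = d i]. *)
rewrite (bigD1_seq (d i)) ?undup_uniq ?mem_undup ?map_f //= eqxx.
by rewrite big1 ?addr0 // => j; rewrite eq_sym => /negPf ->.
Qed.

Section LinearSum.
Variables (K : fieldType) (V W : lmodType K) (f : V -> W).
Hypothesis f_lin : linear f.
HB.instance Definition _ := GRing.isLinear.Build K V W *:%R f f_lin.

Lemma linear_fun_sum I (r : seq I) (P : pred I) (F : I -> V) :
  f (\sum_(i <- r | P i) F i) = \sum_(i <- r | P i) f (F i).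
Proof. exact: linear_sum. Qed.

Lemma linear_fun0 : f 0 = 0.
Proof. exact: linear0. Qed.

Lemma linear_funZ c v : f (c *: v) = c *: f v.
Proof. exact: linearZ. Qed.
End LinearSum.

Lemma linear_sum_fun (K : fieldType) (V W : lmodType K) I (r : seq I)
    (F : I -> V -> W) :
  (forall i, linear (F i)) -> linear (fun v => \sum_(i <- r) F i v).
Proof.
move=> lF c u v; rewrite scaler_sumr -big_split.
by apply: eq_bigr => i _; rewrite lF.
Qed.

Lemma linear_scale_fun (K : fieldType) (V W : lmodType K) (c : K)
    (F : V -> W) :
  linear F -> linear (fun v => c *: F v).
Proof. by move=> lF d u v; rewrite lF scalerDr !scalerA mulrC. Qed.

(** * Linear maps defined degree by degree on a graded space *)

Section GradedSum.
Variables (K : fieldType) (G : zmodType) (V : lmodType K).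
Variable gr : G -> V -> Prop.
Hypothesis gV : is_grading gr.

Lemma grading_sum g I (r : seq I) (P : pred I) (F : I -> V) :
  (forall i, P i -> gr g (F i)) -> gr g (\sum_(i <- r | P i) F i).
Proof.
move=> h; apply: big_ind h => [|u v gu gv]; first exact: grading0.
by rewrite -[u]scale1r; apply: gradingP.
Qed.

Lemma grading_pairs (v : V) : exists s : seq (G * V),
  (forall p, p \in s -> gr p.1 p.2) /\ v = \sum_(p <- s) p.2.
Proof.
have [s [f [hf ->]]] := grading_span gV v.
exists [seq (g, f g) | g <- s]; rewrite big_map; split=> // p.
by case/mapP=> g _ ->.
Qed.

(** A degree may occur several times in the chosen list, and the choice itself is not linear in [v];
    only sums over it will be. *)
Definition components (v : V) : seq (G * V) := projT1 (cid (grading_pairs v)).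

Lemma components_gr v p : p \in components v -> gr p.1 p.2.
Proof. exact: (projT2 (cid (grading_pairs v))).1. Qed.

Lemma components_sum v : \sum_(p <- components v) p.2 = v.
Proof. by rewrite -(projT2 (cid (grading_pairs v))).2. Qed.

Section GradedMap.
Variables (W : lmodType K) (phi : G -> V -> W).
Hypothesis phi_lin : forall g, linear (phi g).

Definition graded_map (v : V) : W := \sum_(p <- components v) phi p.1 p.2.

(** Collect the entries by degree: directness kills the total in each degree [g], and the linear map
    [phi g] sends that total to 0. *)
Lemma graded_sum_eq0 (s : seq (G * V)) :
  (forall p, p \in s -> gr p.1 p.2) -> \sum_(p <- s) p.2 = 0 ->
  \sum_(p <- s) phi p.1 p.2 = 0.
Proof.
move=> hs; rewrite (sum_regroup _ fst) [RHS]/= => s0.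
rewrite (sum_regroup _ fst) big_seq big1 // => g gs.
rewrite (eq_bigr (fun p => phi g p.2)) => [|p /eqP <- //].
rewrite -(linear_fun_sum (phi_lin g)).
rewrite (grading_direct gV (undup_uniq _) _ s0) ?linear_fun0 // => h.
rewrite big_seq_cond; apply: grading_sum => p /andP[ps /eqP <-]; exact: hs.
Qed.

(** This is independence of the chosen decomposition: one decomposition of [v] followed by the
    negatives of another is a decomposition of 0. *)
Lemma graded_mapE (s : seq (G * V)) v :
  (forall p, p \in s -> gr p.1 p.2) -> \sum_(p <- s) p.2 = v ->
  graded_map v = \sum_(p <- s) phi p.1 p.2.
Proof.
move=> hs sv; apply/eqP; rewrite -subr_eq0 -sumrN; apply/eqP.
have := @graded_sum_eq0 (components v ++ [seq (p.1, - p.2) | p <- s]).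
rewrite !big_cat !big_map /= components_sum sumrN sv subrr.
under [in X in _ + X]eq_bigr => p _ do
  rewrite -scaleN1r (linear_funZ (phi_lin _)) scaleN1r.
apply=> // p; rewrite mem_cat => /orP[/components_gr //|].
case/mapP=> q /hs gq -> /=.
rewrite -scaleN1r -[_ *: _]addr0; apply: gradingP => //; exact: grading0.
Qed.

Lemma graded_map_homog g v : gr g v -> graded_map v = phi g v.
Proof.
move=> gv; rewrite (@graded_mapE [:: (g, v)]) ?big_seq1 // => p.
by rewrite inE => /eqP ->.
Qed.

Lemma graded_map_linear : linear graded_map.
Proof.
move=> c u v.
(* The rescaled components of [u] followed by those of [v] decompose [c *: u + v], although they
   need not be the components chosen for it. *)
rewrite (@graded_mapE ([seq (p.1, c *: p.2) | p <- components u]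
                        ++ components v)).
- rewrite big_cat big_map scaler_sumr; congr (_ + _).
  by apply: eq_bigr => p _; rewrite linear_funZ.
- move=> p; rewrite mem_cat => /orP[|/components_gr //].
  case/mapP=> q /components_gr gq -> /=.
  rewrite -[_ *: _]addr0; apply: gradingP => //; exact: grading0.
by rewrite big_cat big_map -scaler_sumr !components_sum.
Qed.

End GradedMap.
End GradedSum.

(** * Bilinear maps rescaled by a weight depending on the two degrees *)

Section Twist.
Variables (K : fieldType) (G : zmodType) (U V W : lmodType K).
Variables (grU : G -> U -> Prop) (grV : G -> V -> Prop).
Hypotheses (gU : is_grading grU) (gV : is_grading grV).
Variables (w : G -> G -> K) (f : U -> V -> W).
Hypotheses (f_linl : forall v, linear (f^~ v)) (f_linr : forall u, linear (f u)).

Definition twist (u : U) (v : V) : W :=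
  graded_map gU (fun g u' => graded_map gV (fun h v' => w g h *: f u' v') v) u.

Let twist_lin2 g u' h : linear (fun v' => w g h *: f u' v').
Proof. exact: linear_scale_fun. Qed.

Let twist_lin1 g v :
  linear (fun u' => graded_map gV (fun h v' => w g h *: f u' v') v).
Proof. by apply: linear_sum_fun => p; apply: linear_scale_fun. Qed.

Lemma twist_linl v : linear (twist^~ v).
Proof. by apply: graded_map_linear => g; apply: twist_lin1. Qed.

Lemma twist_linr u : linear (twist u).
Proof. by apply: linear_sum_fun => p; apply: graded_map_linear. Qed.

Lemma twist_homog g h u v :
  grU g u -> grV h v -> twist u v = w g h *: f u v.
Proof.
by move=> gu hv; rewrite /twist (graded_map_homog _ _ gu) ?(graded_map_homog _ _ hv).
Qed.

End Twist.

(** * Linear and bilinear maps out of tensor products *)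

Lemma tensor_lift_ex (K : fieldType) (U V W : lmodType K) (f : U -> V -> W) :
  (forall v, linear (f^~ v)) -> (forall u, linear (f u)) ->
  exists F : {linear tensor U V -> W}, forall x a, F (x \ot a) = f x a.
Proof.
move=> fl fr; pose B := bilinear_isBilinear.Build K U V W *:%R *:%R f (fl, fr).
pose fB : {bilinear U -> V -> W} := HB.pack f B.
exists (tensor_lift fB) => x a; exact: (tensor_liftE fB).
Qed.

Lemma tensor_ind (K : fieldType) (U V : lmodType K) (P : tensor U V -> Prop) :
  P 0 -> (forall t u, P t -> P u -> P (t + u)) ->
  (forall x a, P (x \ot a)) -> forall t, P t.
Proof.
by move=> P0 PD Pt t; have [s ->] := tensor_span t; apply: big_ind.
Qed.

Section Lift4.
Variables (K : fieldType) (U V U' V' W : lmodType K).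
Variable f : U -> V -> U' -> V' -> W.
Hypotheses (f1 : forall a y b, linear (fun x => f x a y b))
           (f2 : forall x y b, linear (fun a => f x a y b))
           (f3 : forall x a b, linear (fun y => f x a y b))
           (f4 : forall x a y, linear (f x a y)).

(** The universal property is used twice: for fixed [(x, a)] it lifts the last two arguments to a
    linear [L (x, a)]; for a fixed tensor [u], [L (x, a) u] is bilinear in [x] and [a] and lifts in
    turn to [M u]. *)
Lemma tensor_lift4_ex :
  exists F : {bilinear tensor U V -> tensor U' V' -> W},
    forall x a y b, F (x \ot a) (y \ot b) = f x a y b.
Proof.
have [L LE] : exists L : U * V -> {linear tensor U' V' -> W},
    forall p y b, L p (y \ot b) = f p.1 p.2 y b.
  have [L LE] := choice (fun p : U * V =>
    tensor_lift_ex (fun b => f3 p.1 p.2 b) (fun y => f4 p.1 p.2 y)).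
  by exists L.
have Ll a u : linear (fun x => L (x, a) u).
  move=> c x y; elim/tensor_ind: u => [|t u IHt IHu|z b].
  - by rewrite !linear0 addr0.
  - by rewrite !linearD IHt IHu addrACA.
  - by rewrite !LE f1.
have Lr x u : linear (fun a => L (x, a) u).
  move=> c a a'; elim/tensor_ind: u => [|t u IHt IHu|z b].
  - by rewrite !linear0 addr0.
  - by rewrite !linearD IHt IHu addrACA.
  - by rewrite !LE f2.
have [M ME] := choice (fun u => tensor_lift_ex (Ll^~ u) (Lr^~ u)).
have Ml u : linear (M u) by move=> c t t'; rewrite linearP.
have Mr t : linear (M^~ t).
  move=> c u u'; elim/tensor_ind: t => [|t t' IHt IHt'|x a].
  - by rewrite !linear0 addr0.
  - by rewrite !linearD IHt IHt' addrACA.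
  - by rewrite !ME linearP.
pose F t u := M u t.
pose B := bilinear_isBilinear.Build K _ _ W *:%R *:%R F (Ml, Mr).
pose FB : {bilinear tensor U V -> tensor U' V' -> W} := HB.pack F B.
exists FB => x a y b; rewrite -[LHS]/(M (y \ot b) (x \ot a)) ME; exact: LE.
Qed.

End Lift4.

(** * The total grading on the tensor product *)

Section TensorGrading.
Variables (K : fieldType) (G : zmodType) (U V : lmodType K).
Variables (grU : G -> U -> Prop) (grV : G -> V -> Prop).
Hypotheses (gU : is_grading grU) (gV : is_grading grV).
Local Notation gr := (tensor_grading grU grV).

Lemma tensor_grading_tens h k x a :
  grU h x -> grV k a -> gr (h + k) (x \ot a).
Proof.
move=> gx ga; exists [:: (x, a)]; rewrite big_seq1; split=> // p.
by rewrite inE => /eqP ->; exists h, k.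
Qed.

Lemma tensor_grading0 g : gr g 0.
Proof. by exists [::]; rewrite big_nil. Qed.

Lemma tensor_gradingD g t u : gr g t -> gr g u -> gr g (t + u).
Proof.
move=> [r [-> hr]] [s [-> hs]]; exists (r ++ s); rewrite big_cat; split=> // p.
by rewrite mem_cat => /orP[/hr|/hs].
Qed.

Lemma tensor_grading_ind g (P : tensor U V -> Prop) :
  P 0 -> (forall t u, P t -> P u -> P (t + u)) ->
  (forall h k x a, grU h x -> grV k a -> h + k = g -> P (x \ot a)) ->
  forall t, gr g t -> P t.
Proof.
move=> P0 PD Pt t [s [-> hs]]; rewrite big_seq; apply: big_ind => // p /hs.
by case=> h [k [gx ga e]]; apply: Pt gx ga e.
Qed.

Lemma tensor_gradingZ g c t : gr g t -> gr g (c *: t).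
Proof.
elim/tensor_grading_ind => [|u v IHu IHv|h k x a gx ga <-].
- by rewrite scaler0; apply: tensor_grading0.
- by rewrite scalerDr; apply: tensor_gradingD.
- rewrite -linearZl_LR; apply: tensor_grading_tens => //.
  by rewrite -[_ *: _]addr0; apply: gradingP => //; apply: grading0.
Qed.

(** Expanding both factors of a pure tensor into homogeneous components writes every tensor as a sum
    of homogeneous pure ones. *)
Lemma homog_tensor_ind (P : tensor U V -> Prop) :
  P 0 -> (forall t u, P t -> P u -> P (t + u)) ->
  (forall h k x a, grU h x -> grV k a -> P (x \ot a)) ->
  forall t, P t.
Proof.
move=> P0 PD Pt; elim/tensor_ind => // x a.
rewrite -(components_sum gU x) -(components_sum gV a) linear_sumlz.
rewrite big_seq; apply: big_ind => // p /components_gr gp.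
rewrite linear_sumr big_seq; apply: big_ind => // q /components_gr gq.
exact: Pt gp gq.
Qed.

(* The projection onto degree g multiplies the summand U_h (x) V_k by 1 or 0
   according to whether h + k = g. *)
Lemma tensor_proj_ex g : exists P : {linear tensor U V -> tensor U V},
  forall h t, gr h t -> P t = if h == g then t else 0.
Proof.
pose w h k : K := (h + k == g)%:R.
have tl (a : V) : linear (fun x : U => x \ot a).
  by move=> c x y; rewrite linearPl.
have tr (x : U) : linear (fun a : V => x \ot a) by move=> c a b; rewrite linearPr.
have [P PE] := tensor_lift_ex
  (fun a => twist_linl gU gV w tl a)
  (fun x => twist_linr gU gV w tr x).
exists P => h t; elim/tensor_grading_ind => [|u v IHu IHv|i j x a gx ga <-].
- by rewrite linear0 if_same.
- by rewrite linearD IHu IHv; case: ifP; rewrite ?addr0.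
- rewrite PE (twist_homog _ _ _ tl tr gx ga) /w.
  by case: ifP => _; rewrite ?scale1r ?scale0r.
Qed.

Lemma tensor_is_grading : is_grading gr.
Proof.
split.
- exact: tensor_grading0.
- by move=> g c u v gu gv; apply/tensor_gradingD/gv/tensor_gradingZ.
- move=> t.
  have [s [hs ->]] : exists s : seq (G * tensor U V),
      (forall p, p \in s -> gr p.1 p.2) /\ t = \sum_(p <- s) p.2.
    elim/homog_tensor_ind: t => [|t u [r [hr ->]] [s [hs ->]]|h k x a gx ga].
    + by exists [::]; rewrite big_nil.
    + exists (r ++ s); rewrite big_cat; split=> // p.
      by rewrite mem_cat => /orP[/hr|/hs].
    + exists [:: (h + k, x \ot a)]; rewrite big_seq1; split=> // p.
      by rewrite inE => /eqP ->; apply: tensor_grading_tens.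
  (* A family indexed by degrees is required, so summands of equal degree are merged; degrees absent
     from [s] receive the empty sum 0. *)
  exists (undup (map fst s)), (fun g => \sum_(p <- s | p.1 == g) p.2).
  split=> [g|]; last exact: sum_regroup.
  rewrite big_seq_cond; apply: big_ind => [|u v|p /andP[/hs gp /eqP <-] //].
    exact: tensor_grading0.
  exact: tensor_gradingD.
- move=> s f us hf s0 g gs; have [P PE] := tensor_proj_ex g.
  (* Directness: projecting the vanishing sum onto degree [g] leaves exactly the term [f g]. *)
  have := congr1 P s0; rewrite linear0 linear_sum (bigD1_seq g) //=.
  rewrite (PE _ _ (hf g)) eqxx big1 ?addr0 // => h /negPf hg.
  by rewrite (PE _ _ (hf h)) hg.
Qed.

End TensorGrading.

(** * Existence and uniqueness of the twisted product *)

Section ColorTensor.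
Variables (K : fieldType) (G : zmodType) (eps : G -> G -> K).
Variables (S A : lmodType K) (grS : G -> S -> Prop) (grA : G -> A -> Prop).
Hypotheses (gS : is_grading grS) (gA : is_grading grA).
Variables (muS : {bilinear S -> S -> S}) (muA : {bilinear A -> A -> A}).

Lemma color_tensor_mul_ex :
  exists mu : {bilinear tensor S A -> tensor S A -> tensor S A},
    is_color_tensor_mul grS grA muS muA eps mu.
Proof.
(* The outer factors [x], [b] come first, so that [f x b] is a bilinear map of [a] and [y], the two
   arguments whose degrees enter the sign factor. *)
pose f x b a y : tensor S A := muS x y \ot muA a b.
have fx b a y : linear (fun x => f x b a y).
  by move=> c u v; rewrite /f linearPl linearPl.
have fb x a y : linear (fun b => f x b a y).
  by move=> c u v; rewrite /f linearPr linearPr.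
have fa x b y : linear (fun a => f x b a y).
  by move=> c u v; rewrite /f linearPl linearPr.
have fy x b a : linear (f x b a).
  by move=> c u v; rewrite /f linearPr linearPl.
pose F x a y b := twist gA gS eps (f x b) a y.
have Fx a y b : linear (fun x => F x a y b).
  (* The components involved are those of [a] and [y], hence fixed while [x] varies; the same holds
     for [b] below. *)
  apply: linear_sum_fun => p; apply: linear_sum_fun => q.
  exact: linear_scale_fun.
have Fb x a y : linear (F x a y).
  apply: linear_sum_fun => p; apply: linear_sum_fun => q.
  exact: linear_scale_fun.
have Fa x y b := twist_linl gA gS eps (fa x b) y.
have Fy x a b := twist_linr gA gS eps (fy x b) a.
have [mu muE] := tensor_lift4_ex Fx Fa Fy Fb.
exists mu => dx da dy db x a y b _ ga gy _.
by rewrite muE /F (twist_homog _ _ _ (fa x b) (fy x b) ga gy).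
Qed.

(** Homogeneous pure tensors span, and the defining formula fixes a bilinear product on them. *)
Lemma color_tensor_mul_uniq
    (mu mu' : {bilinear tensor S A -> tensor S A -> tensor S A}) :
  is_color_tensor_mul grS grA muS muA eps mu ->
  is_color_tensor_mul grS grA muS muA eps mu' -> mu' =2 mu.
Proof.
move=> hmu hmu' t u.
elim/(homog_tensor_ind gS gA): t => [|t t' IH IH'|dx da x a gx ga].
- by rewrite !linear0l.
- by rewrite !linearDl IH IH'.
elim/(homog_tensor_ind gS gA): u => [|t t' IH IH'|dy db y b gy gb].
- by rewrite !linear0r.
- by rewrite !linearDr IH IH'.
by rewrite (hmu' _ _ _ _ _ _ _ _ gx ga gy gb) (hmu _ _ _ _ _ _ _ _ gx ga gy gb).
Qed.

End ColorTensor.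

(** * Evenness and left symmetry of the twisted product *)

Section ColorTensorLeftSymmetric.
Variables (K : fieldType) (G : zmodType) (eps : G -> G -> K).
Variables (S A : lmodType K) (grS : G -> S -> Prop) (grA : G -> A -> Prop).
Variables (muS : {bilinear S -> S -> S}) (muA : {bilinear A -> A -> A}).
Variables (alphaS : {linear S -> S}) (alphaA : {linear A -> A}).
Hypotheses (hS : hom_left_symmetric_color grS muS eps alphaS)
  (hA : hom_associative_color grA muA eps alphaA)
  (cA : color_commutative grA muA eps).
Variable mu : {bilinear tensor S A -> tensor S A -> tensor S A}.
Hypothesis muE : is_color_tensor_mul grS grA muS muA eps mu.

Let eE := hlsc_bichar hS.
Local Notation gr := (tensor_grading grS grA).
Local Notation alpha := (tensor_map alphaS alphaA).

Lemma color_tensor_mul_even : even_bilinear gr mu.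
Proof.
move=> g h t u gt gu.
elim/tensor_grading_ind: gt => [|t1 t2 IH IH'|dx da x a gx ga <-].
- by rewrite linear0l; apply: tensor_grading0.
- by rewrite linearDl; apply: tensor_gradingD.
elim/tensor_grading_ind: gu => [|t1 t2 IH IH'|dy db y b gy gb <-].
- by rewrite linear0r; apply: tensor_grading0.
- by rewrite linearDr; apply: tensor_gradingD.
(* The total degree is regrouped as [(dx + dy) + (da + db)], matching the two factors of the
   product. *)
rewrite (muE gx ga gy gb) addrACA.
apply: tensor_gradingZ (hlsc_grading hS) _ _ _ _.
apply: tensor_grading_tens; first exact: (hlsc_mul_even hS).
exact: (hac_mul_even hA).
Qed.

Lemma tensor_map_even : even_linear gr alpha.
Proof.
move=> g t; elim/tensor_grading_ind => [|t1 t2 IH IH'|dx da x a gx ga <-].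
- by rewrite linear0; apply: tensor_grading0.
- by rewrite linearD; apply: tensor_gradingD.
rewrite tensor_mapE; apply: tensor_grading_tens.
  exact: (hlsc_alpha_even hS).
exact: (hac_alpha_even hA).
Qed.

Lemma color_tensor_associator dx da dy db dz dc x a y b z c :
  grS dx x -> grA da a -> grS dy y -> grA db b -> grS dz z -> grA dc c ->
  mu (mu (x \ot a) (y \ot b)) (alpha (z \ot c))
    - mu (alpha (x \ot a)) (mu (y \ot b) (z \ot c))
  = (eps da dy * eps da dz * eps db dz)
    *: ((muS (muS x y) (alphaS z) - muS (alphaS x) (muS y z))
        \ot muA (muA a b) (alphaA c)).
Proof.
move=> gx ga gy gb gz gc; rewrite !tensor_mapE (muE gx ga gy gb) (muE gy gb gz gc).
rewrite linearZl_LR linearZr_LR /=.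
have gSa := hlsc_alpha_even hS; have gAa := hac_alpha_even hA.
rewrite (muE (hlsc_mul_even hS gx gy) (hac_mul_even hA ga gb)
  (gSa _ _ gz) (gAa _ _ gc)).
rewrite (muE (gSa _ _ gx) (gAa _ _ ga)
  (hlsc_mul_even hS gy gz) (hac_mul_even hA gb gc)).
(* Hom-associativity gives both terms the same factor in [A]. Their scalars
   [eps da dy * eps (da + db) dz] and [eps db dz * eps da (dy + dz)] agree after expansion. *)
rewrite (hac_assoc hA ga gb gc) !scalerA (bicharDl eE) (bicharDr eE).
by rewrite linearBl scalerBr mulrA [eps db dz * _]mulrC.
Qed.

Lemma color_tensor_left_sym g h k t u v : gr g t -> gr h u -> gr k v ->
  mu (mu t u) (alpha v) - mu (alpha t) (mu u v) =
  eps g h *: (mu (mu u t) (alpha v) - mu (alpha u) (mu t v)).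
Proof.
move=> gt gu gv.
elim/tensor_grading_ind: gt => [|t1 t2 IH IH'|dx da x a gx ga <-].
- by rewrite !(linear0, linear0l, linear0r, subrr).
(* Both sides are additive in each of the three arguments, which permits the reduction to
   homogeneous pure tensors. *)
- by rewrite [alpha (_ + _)]linearD !(linearDl, linearDr) !opprD
     !(addrACA _ _ (- _)) IH IH' -scalerDr.
elim/tensor_grading_ind: gu => [|t1 t2 IH IH'|dy db y b gy gb <-].
- by rewrite !(linear0, linear0l, linear0r, subrr).
- by rewrite [alpha (_ + _)]linearD !(linearDl, linearDr) !opprD
     !(addrACA _ _ (- _)) IH IH' -scalerDr.
elim/tensor_grading_ind: gv => [|t1 t2 IH IH'|dz dc z c gz gc _].
- by rewrite !(linear0, linear0l, linear0r, subrr).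
- by rewrite [alpha (_ + _)]linearD !(linearDl, linearDr) !opprD
     !(addrACA _ _ (- _)) IH IH' -scalerDr.
rewrite (color_tensor_associator gx ga gy gb gz gc).
rewrite (color_tensor_associator gy gb gx ga gz gc).
rewrite (hlsc_left_sym hS gx gy gz) (cA ga gb) !linearZl_LR linearZr_LR /=.
rewrite !scalerA !(bicharDl eE) !(bicharDr eE); congr (_ *: _).
(* The right-hand scalar has the extra factor [eps dx db * eps db dx], which is 1 by skew-symmetry
   of the bicharacter. *)
rewrite -[LHS]mul1r -(bichar_skew eE dx db); ring.
Qed.

End ColorTensorLeftSymmetric.

Theorem theorem2p6 (K : fieldType) (charK : 2%N \notin [pchar K])
    (G : zmodType) (eps : G -> G -> K)
    (S : lmodType K) (grS : G -> S -> Prop)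
    (muS : {bilinear S -> S -> S}) (alphaS : {linear S -> S})
    (A : lmodType K) (grA : G -> A -> Prop)
    (muA : {bilinear A -> A -> A}) (alphaA : {linear A -> A})
    (hS : hom_left_symmetric_color grS muS eps alphaS)
    (hA : hom_associative_color grA muA eps alphaA)
    (cA : color_commutative grA muA eps) :
  exists mu : {bilinear tensor S A -> tensor S A -> tensor S A},
    [/\ is_color_tensor_mul grS grA muS muA eps mu,
        forall mu' : {bilinear tensor S A -> tensor S A -> tensor S A},
          is_color_tensor_mul grS grA muS muA eps mu' -> mu' =2 mu
      & hom_left_symmetric_color (tensor_grading grS grA) mu eps
          (tensor_map alphaS alphaA)].
Proof.
have gS := hlsc_grading hS; have gA := hac_grading hA.
have [mu muE] := color_tensor_mul_ex eps gS gA muS muA.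
exists mu; split=> // [mu' muE'|]; first exact: color_tensor_mul_uniq muE muE'.
split.
- exact: tensor_is_grading.
- exact: color_tensor_mul_even hS hA _ muE.
- exact: hlsc_bichar hS.
- exact: tensor_map_even hS hA.
- exact: color_tensor_left_sym hS hA cA _ muE.
Qed.
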